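(* For every integer $n\ge1$, every complex root $z\neq-1$ of $P_n(z)$ satisfies $\sqrt2-1<|z|<1$.
   Context: For $0\le k\le n$ let $\mathcal{B}(n,k)=\binom{n}{\lfloor (n-k)/2\rfloor}$ and let $P_n(z)=\sum_{k=0}^n\mathcal{B}(n,k)z^{n-k}$. The root $-1$ (a root exactly when $n$ is odd) is called the trivial root. *)

(* Defs.v *)
From mathcomp Require Import all_boot all_order all_algebra.

Set Implicit Arguments.
Unset Strict Implicit.
Unset Printing Implicit Defensive.

Import GRing.Theory.
Local Open Scope ring_scope.

(* Only meaningful for k <= n: ssrnat subtraction truncates. *)
Definition Bcoef (n k : nat) : nat := 'C(n, (n - k)./2).

Definition Bpoly (C : nzRingType) (n : nat) : {poly C} :=
  \sum_(k < n.+1) (Bcoef n k)%:R *: 'X^(n - k).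

(* Main.v *)
(** Coefficientwise, [(1 + x) (1 + x^2)^n = P_n(x) + x^(n+1) P_n^*(x)], where
    [P_n^*] is the reciprocal polynomial of [P_n]; at [x = 1] this gives
    [P_n(1) = 2^n].  If [P_n(z) = 0] with [r = |z| <= 1], it follows that
    [(1 - r) (1 - r^2)^n <= 2^n r^(n+1)], which fails when [r <= sqrt 2 - 1],
    because then [1 - r^2 >= 2 r] and [1 - r > r].
    The upper bound is the Enestrom-Kakeya argument: the coefficients of [P_n]
    are nondecreasing, and the jump [n - 1] in degree [2] makes the triangle
    inequality strict unless [z^2 = 1]. *)

Require Import Defs.
From mathcomp Require Import all_boot all_order all_algebra.
From mathcomp Require Import reals complex.
From mathcomp Require Import ring lra zify.

Import Order.TTheory GRing.Theory Num.Theory.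
Local Open Scope ring_scope.
Local Open Scope complex_scope.

Lemma sum_double (V : nmodType) (F : nat -> V) (m : nat) :
  \sum_(j < m.*2) F j = \sum_(i < m) (F i.*2 + F i.*2.+1).
Proof.
elim: m => [|m IHm]; first by rewrite !big_ord0.
by rewrite doubleS !big_ord_recr /= IHm addrA.
Qed.

Lemma horner_Bpoly (C : comNzRingType) (n : nat) (x : C) :
  (Bpoly C n).[x] = \sum_(j < n.+1) 'C(n, j./2)%:R * x ^+ j.
Proof.
rewrite /Bpoly horner_sum (reindex_inj rev_ord_inj) /=.
apply: eq_bigr => j _; rewrite !hornerE /Bcoef subSS subKn //.
by rewrite -ltnS.
Qed.

(** The product has coefficient ['C(n, i)] in both degrees [2i] and [2i + 1]; the sum is then cut
    after degree [n]. *)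
Lemma Bpoly_reciprocal (C : comNzRingType) (n : nat) (x : C) :
  (1 + x) * (1 + x ^+ 2) ^+ n =
  (Bpoly C n).[x] + x ^+ n.+1 * \sum_(k < n.+1) (Bcoef n k)%:R * x ^+ k.
Proof.
transitivity (\sum_(j < n.+1.*2) 'C(n, j./2)%:R * x ^+ j).
  rewrite (sum_double _ (fun j => 'C(n, j./2)%:R * x ^+ j)) exprDn mulr_sumr.
  apply: eq_bigr => i _.
  rewrite /= expr1n mul1r uphalf_double doubleK -exprM mul2n exprS -mulr_natl.
  ring.
rewrite horner_Bpoly -addnn big_split_ord /=; congr (_ + _).
rewrite mulr_sumr; apply: eq_bigr => k _.
rewrite exprD mulrCA; congr (_ * (_%:R * _)).
(* Binomial symmetry applies, because [n - (n - k)./2 = (n + 1 + k)./2]. *)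
have le_kn : (k <= n)%N by rewrite -ltnS.
have le_h : ((n - k)./2 <= n)%N by lia.
rewrite /Bcoef -(bin_sub le_h); congr 'C(n, _).
by lia.
Qed.

Lemma horner_Bpoly1 (C : comNzRingType) (n : nat) :
  (Bpoly C n).[1] = \sum_(k < n.+1) (Bcoef n k)%:R.
Proof.
rewrite /Bpoly horner_sum; apply: eq_bigr => k _.
by rewrite !hornerE expr1n mulr1.
Qed.

(** At [x = 1] both sums in the reciprocal identity coincide, and a factor 2 cancels. *)
Lemma sum_Bcoef (C : numDomainType) (n : nat) :
  \sum_(k < n.+1) (Bcoef n k)%:R = 2 ^+ n :> C.
Proof.
have := Bpoly_reciprocal C n 1; rewrite !expr1n mul1r horner_Bpoly1.
under [X in _ = _ + X]eq_bigr do rewrite expr1n mulr1.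
have two_neq0 : 1 + 1 != 0 :> C by rewrite -mulr2n pnatr_eq0.
by move=> two_sums; apply: (mulfI two_neq0); rewrite mulrDl mul1r -two_sums.
Qed.

Lemma Bpoly_root_le (C : numDomainType) (n : nat) (z : C) :
  root (Bpoly C n) z -> `|z| <= 1 ->
  (1 - `|z|) * (1 - `|z| ^+ 2) ^+ n <= 2 ^+ n * `|z| ^+ n.+1.
Proof.
move=> /rootP Pz0 le_z1.
have le_z21 : `|z| ^+ 2 <= 1 by rewrite exprn_ile1.
have := congr1 Num.norm (Bpoly_reciprocal C n z).
rewrite Pz0 add0r !normrM !normrX => eqN.
(* Reverse triangle inequality [1 - |w| <= |1 + w|] for [w = z] and [w = z^2]. *)
apply: (@le_trans _ _ (`|1 + z| * `|1 + z ^+ 2| ^+ n)).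
  apply: ler_pM; rewrite ?exprn_ge0 ?subr_ge0 //.
    by rewrite -{1}(normr1 C) -(normrN z) -{2}(opprK z) lerB_dist.
  apply: lerXn2r; rewrite ?nnegrE ?subr_ge0 //.
  by rewrite -{1}(normr1 C) -normrX -(normrN (z ^+ 2)) -{2}(opprK (z ^+ 2))
    lerB_dist.
rewrite eqN mulrC ler_wpM2r ?exprn_ge0 // -sum_Bcoef.
apply: (le_trans (ler_norm_sum _ _ _)); apply: ler_sum => k _.
by rewrite normrM normr_nat normrX ler_piMr // exprn_ile1.
Qed.

(** The second hypothesis is [(r + 1)^2 <= 2], that is [r <= sqrt 2 - 1] without the root. The case
    [r = 0] is separate because the strict step multiplies by [(2 r)^n], which must be positive. *)
Lemma lower_gap (R : realFieldType) (n : nat) (r : R) :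
  0 <= r -> r ^+ 2 + 2 * r <= 1 ->
  2 ^+ n * r ^+ n.+1 < (1 - r) * (1 - r ^+ 2) ^+ n.
Proof.
move=> r_ge0 r_le; have [->|r_neq0] := eqVneq r 0.
  by rewrite !expr0n !subr0 expr1n !mulr0 mulr1.
have r_gt0 : 0 < r by rewrite lt_def r_neq0.
rewrite exprS mulrCA -exprMn.
apply: (@lt_le_trans _ _ ((1 - r) * (2 * r) ^+ n)).
  by rewrite ltr_pM2r ?exprn_gt0 ?mulr_gt0 //; nra.
apply: ler_wpM2l; first nra.
by apply: lerXn2r; rewrite ?nnegrE; nra.
Qed.

(* The quantity in the norm is [- (a_0 + sum_(j < m0) (a_(j+1) - a_j) z^(j+1))];
   the strict inequality in degree [m0] survives as further jumps are added. *)
Lemma monotone_sum_neq0 (C : numDomainType) (a : nat -> C) (m0 n : nat)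
    (z : C) :
  (forall m, 0 <= a m) -> (forall m, (m0 <= m < n)%N -> a m <= a m.+1) ->
  (m0 <= n)%N -> 1 <= `|z| ->
  `|(z - 1) * \sum_(j < m0.+1) a j * z ^+ j - a m0 * z ^+ m0.+1|
    < a m0 * `|z| ^+ m0 ->
  \sum_(j < n.+1) a j * z ^+ j != 0.
Proof.
move=> a_ge0 a_mono le_m0n z_ge1 base.
have scale m : a m * `|z| ^+ m <= a m * `|z| ^+ m.+1.
  by rewrite ler_wpM2l // exprS ler_peMl ?exprn_ge0.
have step m : (m0 <= m <= n)%N ->
  `|(z - 1) * \sum_(j < m.+1) a j * z ^+ j - a m * z ^+ m.+1|
    < a m * `|z| ^+ m.
  elim: m => [|m IHm] /andP[le_m0m le_mn].
    by move: le_m0m base; rewrite leqn0 => /eqP ->.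
  move: le_m0m; rewrite leq_eqVlt => /predU1P[<- //|]; rewrite ltnS => le_m0m.
  have am : a m <= a m.+1 by rewrite a_mono ?le_m0m.
  rewrite big_ord_recr /=.
  set S := \sum_(j < _) _ in IHm *.
  have -> : (z - 1) * (S + a m.+1 * z ^+ m.+1) - a m.+1 * z ^+ m.+2 =
    ((z - 1) * S - a m * z ^+ m.+1) - (a m.+1 - a m) * z ^+ m.+1.
    by rewrite !exprS; ring.
  (* The new jump costs at most [(a_(m+1) - a_m) |z|^(m+1)], and [scale] lets the bounds
     telescope. *)
  apply: (le_lt_trans (ler_normB _ _)).
  rewrite normrM normrX (ger0_norm (_ : 0 <= a m.+1 - a m)) ?subr_ge0 //.
  rewrite [(a m.+1 - _) * _]mulrBl addrCA gtrDl subr_lt0.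
  by apply: lt_le_trans (scale m); apply: IHm; rewrite le_m0m ltnW.
apply/negP => /eqP S0.
have /step : (m0 <= n <= n)%N by rewrite le_m0n leqnn.
rewrite S0 mulr0 add0r normrN normrM normrX ger0_norm // => gt_scale.
by have := lt_le_trans gt_scale (scale n); rewrite ltxx.
Qed.

(** Only odd [m] moves the index; then [(h + 1) 'C(n, h + 1) = (n - h) 'C(n, h)] with
    [h + 1 <= n - h]. *)
Lemma leq_bin_half (n m : nat) : (m < n)%N -> ('C(n, m./2) <= 'C(n, m.+1./2))%N.
Proof.
move=> lt_mn; rewrite -uphalfE uphalf_half.
case: (boolP (odd m)) => [_|_]; last by rewrite add0n.
rewrite add1n; set h := m./2.
have le_h : (h.+1 <= n - h)%N by rewrite /h; lia.
by rewrite -(leq_pmul2l (ltn0Sn h)) mul_bin_left leq_mul2r le_h orbT.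
Qed.

Lemma Bpoly_root_lt1 (C : numClosedFieldType) (n : nat) (z : C) :
  (1 <= n)%N -> root (Bpoly C n) z -> z <> -1 -> `|z| < 1.
Proof.
move=> n_gt0 /rootP Pz0 z_neqN1; rewrite real_ltNge ?normr_real ?real1 //.
apply/negP => z_ge1.
(* [P_1(z) = 1 + z] has only the trivial root and no term of degree 2. *)
have [n_eq1|n_neq1] := eqVneq n 1%N.
  move: Pz0; rewrite horner_Bpoly n_eq1 !big_ord_recr big_ord0 /=.
  rewrite !bin0 expr0 expr1 add0r !mul1r.
  by move=> /eqP; rewrite addrC addr_eq0 => /eqP.
have z_neq1 : z <> 1.
  move=> z1; move: Pz0; rewrite z1 horner_Bpoly1 sum_Bcoef => /eqP.
  by rewrite expf_eq0 pnatr_eq0 andbF.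
move: Pz0; rewrite horner_Bpoly.
apply/eqP; apply: (@monotone_sum_neq0 C (fun j => 'C(n, j./2)%:R) 2).
- by move=> m; rewrite ler0n.
- by move=> m /andP[_ lt_mn]; rewrite ler_nat leq_bin_half.
- by rewrite ltn_neqAle eq_sym n_neq1.
- by [].
rewrite !big_ord_recr big_ord0 /= bin0 bin1 add0r.
have -> : (z - 1) * (1%:R * z ^+ 0 + 1%:R * z ^+ 1 + n%:R * z ^+ 2)
  - n%:R * z ^+ 3 = - (1 + (n.-1)%:R * z ^+ 2).
  case: n n_gt0 {n_neq1} => // n _; rewrite /= -natr1; ring.
rewrite normrN.
have n1_gt0 : 0 < n.-1%:R :> C by rewrite ltr0n; case: n n_gt0 n_neq1 => [|[]].
have nE : n%:R = 1 + n.-1%:R :> C by rewrite -{1}(prednK n_gt0) nat1r.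
have z2_ge1 : 1 <= `|z| ^+ 2 by rewrite exprn_ege1.
have leN : 1 + `|n.-1%:R * z ^+ 2| <= n%:R * `|z| ^+ 2.
  by rewrite nE mulrDl mul1r normrM normr_nat normrX lerD2r.
rewrite lt_neqAle; apply/andP; split; last first.
  by rewrite (le_trans (ler_normD _ _)) // normr1.
(* Equality forces [|z| = 1] and makes [(n - 1) z^2] a positive multiple of 1, so [z^2 = 1]; both
   square roots are excluded. *)
apply/eqP => eqN.
have eqD : `|1 + n.-1%:R * z ^+ 2| = `|1 : C| + `|n.-1%:R * z ^+ 2|.
  by apply/eqP; rewrite eq_le ler_normD eqN normr1 leN.
have z2_eq1 : `|z| ^+ 2 = 1.
  move: eqN; rewrite eqD nE normr1 normrM normr_nat normrX mulrDl mul1r.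
  by move=> /addIr.
have [t _ [t1 t2]] := normCDeq eqD.
move: t1 t2; rewrite normr1 mul1r => <-.
rewrite normrM normr_nat normrX z2_eq1 mulr1.
move=> /mulfI; rewrite gt_eqF // => /(_ isT) /eqP.
by rewrite sqrf_eq1 => /orP[] /eqP.
Qed.

Theorem theorem4p1 (R : realType) (n : nat) (hn : (1 <= n)%N) (z : R[i])
    (hz : root (Bpoly R[i] n) z) (hz1 : z <> -1) :
  (Num.sqrt (2 : R) - 1)%:C < `|z| /\ `|z| < 1.
Proof.
have z_lt1 := Bpoly_root_lt1 _ n z hn hz hz1; split=> //.
(* The norm on [R[i]] is [R[i]]-valued; a real representative brings the inequalities down to
   [R]. *)
have [r r_ge0 zE] : exists2 r : R, 0 <= r & `|z| = r%:C.
  by case: z {hz hz1 z_lt1} => a b; exists (Num.sqrt (a ^+ 2 + b ^+ 2));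
    rewrite ?sqrtr_ge0 // normc_def.
have := Bpoly_root_le _ n z hz (ltW z_lt1).
rewrite zE ltcR ltNge.
have -> : (1 - r%:C) * (1 - r%:C ^+ 2) ^+ n = ((1 - r) * (1 - r ^+ 2) ^+ n)%:C.
  by rewrite !(rmorphM, rmorphXn, rmorphB, rmorph1).
have -> : 2 ^+ n * r%:C ^+ n.+1 = (2 ^+ n * r ^+ n.+1)%:C.
  by rewrite !(rmorphM, rmorphXn, rmorph_nat).
rewrite lecR => le_pow; apply/negP => r_le.
suff : 2 ^+ n * r ^+ n.+1 < (1 - r) * (1 - r ^+ 2) ^+ n.
  by rewrite ltNge le_pow.
apply: lower_gap => //.
have s2 : Num.sqrt (2 : R) ^+ 2 = 2 by rewrite sqr_sqrtr ?ler0n.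
have s_ge0 : 0 <= Num.sqrt (2 : R) := sqrtr_ge0 _.
nra.
Qed.
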